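(* Let $h:C\to\mathbb{R}$ be a function and let $K:C\rightrightarrows C$ be a set-valued map, where $C$ is a convex and compact subset of a Hausdorff locally convex real topological vector space $X$. If $K$ is closed and lower semicontinuous with convex values, and $h$ is quasiconvex and continuous, then $\mathrm{QOpt}(h,K)$ is nonempty; that is, there exists $x_0\in C$ such that $x_0\in K(x_0)$ and $\min_{z\in K(x_0)} h(z)=h(x_0)$.
   Context: A set-valued map $K:C\rightrightarrows C$ assigns to each $x\in C$ a subset $K(x)\subseteq C$. It is closed if its graph $\{(x,y)\in C\times C: y\in K(x)\}$ is closed in $C\times C$. It is lower semicontinuous if for every open set $V$ the set $\{x\in C: K(x)\cap V\neq\emptyset\}$ is open in $C$. A function $h:C\to\mathbb{R}$ on a convex set $C$ is quasiconvex if $\{x\in C: h(x)\leq\lambda\}$ is convex for every $\lambda\in\mathbb{R}$. The quasi-optimization problem associated with $h$ and $K$ consists in finding $x_0\in K(x_0)$ such that $\min_{z\in K(x_0)} h(z)=h(x_0)$; its solution set is denoted $\mathrm{QOpt}(h,K)$.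
   Formalization: It is additionally assumed that K(x) is nonempty for at least one x in C (so C is nonempty); without this the claim fails, e.g. for K identically empty, and the assumption is implied by the conclusion. *)

(* Defs.v *)
From HB Require Import structures.
From mathcomp Require Import all_boot all_order all_algebra.
From mathcomp Require Import all_classical all_reals all_analysis.

Set Implicit Arguments.
Unset Strict Implicit.
Unset Printing Implicit Defensive.

Import Order.TTheory GRing.Theory Num.Theory.
Import numFieldNormedType.Exports.

Local Open Scope classical_set_scope.
Local Open Scope ring_scope.

(* Objects living on a subset C of X are stated on the type of elements of C
   (the coercion set_type), which carries the subspace topology. A set-valued
   map is a function K : C -> set C; its values may be empty. *)

Section set_valued_maps.
Context {T : topologicalType}.
Implicit Types K : T -> set T.

Definition closed_svmap K := closed [set p : T * T | K p.1 p.2].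

Definition lower_semicontinuous_svmap K :=
  forall V : set T, open V -> open [set x | K x `&` V !=set0].

End set_valued_maps.

Section convexity.
Context {R : realType} {X : lmodType R} {C : set X}.

(* [convex_set] speaks of subsets of X, hence the images under set_val. *)
Definition convex_valued (K : C -> set C) :=
  forall x : C, @convex_set R X (set_val @` K x).

Definition quasiconvex (h : C -> R) :=
  forall lambda : R, @convex_set R X (set_val @` [set x : C | h x <= lambda]).

End convexity.

Definition is_minimum {R : realType} (A : set R) (m : R) := A m /\ lbound A m.

Definition QOpt {R : realType} {T : Type} (h : T -> R) (K : T -> set T) :
    set T :=
  [set x0 | K x0 x0 /\ is_minimum (h @` K x0) (h x0)].

(* Main.v *)
Require Import Defs.
From HB Require Import structures.
From mathcomp Require Import all_boot all_order all_algebra.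
From mathcomp Require Import all_classical all_reals all_analysis.

Set Implicit Arguments.
Unset Strict Implicit.
Unset Printing Implicit Defensive.

Import Order.TTheory GRing.Theory Num.Theory.
Import numFieldNormedType.Exports.

(** Let M x be the set of minimizers of h on K x.  A fixed point of M is exactly
what is sought, so the theorem is an application of the fixed-point theorem of
Kakutani, Fan and Glicksberg ([kakutani_fan_glicksberg]) to M.  Its hypotheses
hold for the following reasons.  The values K x are all nonempty, because the
x with K x nonempty form a clopen subset of the connected set C
([nonempty_values]); hence the values M x are nonempty by compactness.  They
are convex because h is quasiconvex ([convex_argmin]).  The graph of M is closed
by the argument of Berge: if y is not minimal on K x, some z in K x does
strictly better, and by lower semicontinuity of K and continuity of h this
persists for all (x', y') close to (x, y) ([closed_argmin]).

The fixed-point theorem is reduced to a finite statement.  If M has no fixed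
point, every x in C has a neighbourhood on which the values of M stay in a
convex open set A whose closure avoids x; so for a small neighbourhood V of 0 no
point x' of C near x is a convex combination of points of M (x' + V).  By
compactness one V serves for all of C, which contradicts
[approximate_fixed_point]: such an x' exists for every V.  To find it, choose a
finite V-net (a_i) of C, points y_i in M a_i, and label each point t of the
simplex by some i such that a_i is close to the point sum_j t_j y_j.  It is then
enough to have a point p of the simplex such that each i with p_i <> 0 is the
label of some t close to p, for then x' = sum_j p_j y_j is a combination of
those y_i for which a_i is close to x'.

That labelling statement ([simplex_labelling]), which holds for arbitrary
labellings and contains the theorem of Brouwer, is proved on the grid of points
with coordinates in the natural numbers and coordinate sum N, where N is large,
without triangulations, by means of Scarf's lemma ([scarf_rainbow]).  A set of grid points is dominant when no grid
point exceeds, in every coordinate, the least value of that coordinate on the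
set.  The points of a dominant set are close together: their coordinates have
the constant sum N, and dominance makes the least values sum up to almost N.
Scarf's lemma provides a dominant set with all the labels, by the same parity
argument as in Sperner's lemma; dominance in a subset of the coordinates, which
describes the faces of the simplex, is covered by adding one slack point for
each coordinate. *)

(** * Scarf's lemma *)

Section Scarf.
Variables (T I : finType) (r : I -> T -> nat).
Hypothesis r_inj : forall i, injective (r i).
Implicit Types (s t : {set T}) (x y z : T) (i j k : I).

(** Each [r i] ranks T in a linear order.  Dominance says that no y lies above
the least point of s in every one of these orders; quantifying over x in s
instead of naming the least point lets s be empty. *)
Definition dominant s :=
  [forall y, exists i, forall x in s, r i y <= r i x].

Lemma dominantP s :
  reflect (forall y, exists i, forall x, x \in s -> r i y <= r i x)
          (dominant s).
Proof.
apply: (iffP forallP) => H y.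
  by have /existsP[i /forall_inP Hi] := H y; exists i.
by have [i Hi] := H y; apply/existsP; exists i; apply/forall_inP.
Qed.

Definition completions t := [set z | (z \notin t) && dominant (z |: t)].

(** A point x of a dominant set cannot lie above the least points of the set in
all the orders, so it is itself the least point for one of them.  Therefore a
dominant set has at most #|I| points; those with exactly #|I| points play the
role of the full-dimensional simplices of a triangulation. *)
Lemma dominant_argmin s : dominant s ->
  exists g : T -> I,
    {in s, forall x x', x' \in s -> r (g x) x <= r (g x) x'}
    /\ {in s &, injective g}.
Proof.
move=> /dominantP D.
have [g gP] := fin_all_exists D.
exists g; split=> [x _|x x' xs x's e]; first exact: gP.
apply: (@r_inj (g x)); apply/eqP; rewrite eqn_leq gP//= e gP//.
Qed.

(** The analogue of the fact that an inner facet of a triangulation lies in two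
simplices.  If t is completed to a dominant set with #|I| points, the minima of
t in the #|I| orders exhaust its #|I| - 1 points, so exactly two indices i1
and i2 share their minimum.  A completing point z must become the minimum for
one of them, say k, and dominance forces it to be the k-largest of the points
that lie above the minima of t in all the other orders.  There is such a
point for k = i1 and for k = i2, since the slack point of index k is above an
ordinary point of t in all the other orders. *)
Lemma even_completions (slack : I -> T) t x0 :
  (forall i x, x \notin codom slack -> forall j, j != i ->
     r i x < r i (slack j)) ->
  #|t|.+1 = #|I| -> x0 \in t -> x0 \notin codom slack ->
  odd #|completions t| = false.
Proof.
move=> slackP tI x0t x0s.
have [->|[z1 z1P]] := set_0Vmem (completions t); first by rewrite cards0.
pose m i := [arg min_(x < x0 in t) r i x].
have mt i : m i \in t by rewrite /m; case: arg_minnP.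
have mmin i x : x \in t -> r i (m i) <= r i x.
  by rewrite /m; case: arg_minnP => // y yt + xt; apply.
have mE i x : x \in t -> r i x <= r i (m i) -> x = m i.
  by move=> xt le; apply: (@r_inj i); apply/eqP; rewrite eqn_leq le mmin.
have dom y : exists i, r i y <= r i (m i).
  move: z1P; rewrite inE => /andP[_ /dominantP/(_ y)[i Hi]].
  by exists i; apply: Hi; rewrite inE mt orbT.
have [i1 [i2 [i12 mi12]]] : exists i1 i2, i1 != i2 /\ m i1 = m i2.
  have /injectivePn[i1 [i2 i12 e]] : ~~ injectiveb m.
    apply/negP => /injectiveP inj_m.
    have : #|m @: [set: I]| <= #|t|.
      by apply/subset_leq_card/fintype.subsetP => _ /imsetP[i _ ->].
    by rewrite card_imset// cardsT -tI ltnn.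
  by exists i1, i2.
(* the candidates to become the minimum of order k *)
pose A k := [set z | [forall i, (i != k) ==> (r i (m i) < r i z)]].
have AP k z : reflect (forall i, i != k -> r i (m i) < r i z) (z \in A k).
  rewrite inE; apply: (iffP forallP) => [H i ik|H i].
    by have /implyP := H i; apply.
  by apply/implyP; exact: H.
have slackA k : slack k \in A k.
  apply/AP => i ik; apply: leq_ltn_trans (mmin i x0 x0t) _.
  by apply: slackP => //; rewrite eq_sym.
pose top k := [arg max_(z > slack k in A k) r k z].
have topA k : top k \in A k by rewrite /top; case: arg_maxnP.
have topmax k z : z \in A k -> r k z <= r k (top k).
  by rewrite /top; case: arg_maxnP => // y yA + zA; apply.
have twin k : k \in [set i1; i2] -> exists2 k', k' != k & m k' = m k.
  by rewrite !inE => /orP[]/eqP->; [exists i2|exists i1]; rewrite // eq_sym.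
have top_completes k : k \in [set i1; i2] -> top k \in completions t.
  move=> /twin[k' k'k mk']; rewrite inE; apply/andP; split.
    apply/negP => topt; have [i /(mE _ _ topt) e] := dom (top k).
    have /AP topA' := topA k.
    have [ik|ik] := eqVneq i k; last by have := topA' _ ik; rewrite {1}e ltnn.
    by have := topA' _ k'k; rewrite e ik -mk' ltnn.
  apply/dominantP => y; have [yA|] := boolP (y \in A k).
    exists k => x; rewrite !inE => /orP[/eqP->|xt]; first exact: topmax.
    apply: (leq_trans (topmax _ _ yA)); apply: leq_trans (mmin _ _ xt).
    have [i] := dom (top k); have [->//|ik] := eqVneq i k.
    by have /AP/(_ _ ik) := topA k; rewrite ltnNge => /negP.
  rewrite inE negb_forall => /existsP[i].
  rewrite negb_imply -leqNgt => /andP[ik yi].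
  exists i => x; rewrite !inE => /orP[/eqP->|xt].
    by apply: (leq_trans yi); apply: ltnW; have /AP := topA k; apply.
  exact: leq_trans (mmin _ _ xt).
have completion_top z : z \in completions t -> z \in [set top i1; top i2].
  rewrite inE => /andP[zt D].
  have [g [gmin ginj]] := dominant_argmin D.
  have zD : z \in z |: t by rewrite !inE eqxx.
  have tD x : x \in t -> x \in z |: t by rewrite !inE orbC => ->.
  have gm x : x \in t -> m (g x) = x.
    by move=> xt; apply/esym/mE => //; apply: gmin; rewrite ?tD.
  have gsurj i : exists2 x, x \in z |: t & i = g x.
    have : i \in g @: (z |: t).
      suff -> : g @: (z |: t) = [set: I] by rewrite inE.
      apply/eqP; rewrite eqEcard finset.subsetT cardsT (card_in_imset ginj).
      by rewrite cardsU1 zt -tI add1n leqnn.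
    by move=> /imsetP[x xD ->]; exists x.
  have gt i : i != g z -> m i \in t /\ i = g (m i).
    move=> igz; have [x] := gsurj i; rewrite !inE => /orP[/eqP-> e|xt e].
      by move: igz; rewrite e eqxx.
    by rewrite e gm.
  have zA : z \in A (g z).
    apply/AP => i /gt[mit e]; rewrite ltn_neqAle; apply/andP; split.
      by apply: contra zt => /eqP/r_inj <-.
    by have := gmin _ (tD _ mit) _ zD; rewrite -e.
  have gz12 : g z \in [set i1; i2].
    apply: contraT; rewrite !inE negb_or ![g z == _]eq_sym.
    move=> /andP[/gt[_ e1] /gt[_ e2]].
    by move: i12; rewrite e1 e2 mi12 eqxx.
  suff -> : z = top (g z).
    by move: gz12; rewrite !inE => /orP[]/eqP->; rewrite eqxx ?orbT.
  apply: (@r_inj (g z)); apply/eqP; rewrite eqn_leq topmax//=.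
  have /dominantP/(_ (top (g z)))[i Hi] := D.
  have [ig|/[dup]/gt[mit _]] := eqVneq i (g z); first by rewrite -{1 3}ig Hi.
  have /AP/[apply] := topA (g z).
  by rewrite ltnNge Hi// tD.
suff -> : completions t = [set top i1; top i2].
  rewrite cards2; suff -> : top i1 != top i2 by [].
  apply/eqP => e; have [i] := dom (top i1); rewrite leqNgt => /negP; apply.
  have /AP A1 := topA i1; have /AP A2 := topA i2.
  have [->|] := eqVneq i i1; last exact: A1.
  by rewrite e; exact: A2.
apply/setP/subset_eqP/andP; split; apply/fintype.subsetP => z.
  exact: completion_top.
by move=> /set2P[]->; apply: top_completes; rewrite !inE eqxx ?orbT.
Qed.

(** The slack points of all indices but i0 lie on the boundary: they are
completed only by the ordinary point that is largest in the order of i0. *)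
Lemma outer_completion (slack : I -> T) i0 x0 :
  (forall i x, x != slack i -> r i (slack i) < r i x) ->
  (forall i x, x \notin codom slack -> forall j, j != i ->
     r i x < r i (slack j)) ->
  x0 \notin codom slack ->
  #|completions (slack @: [set~ i0])| = 1.
Proof.
move=> slack_low slack_high x0s.
have [z0 z0s z0max] : exists2 z0, z0 \notin codom slack &
    forall z, z \notin codom slack -> r i0 z <= r i0 z0.
  have [z zs zmax] := arg_maxnP (P := fun z => z \notin codom slack) (r i0) x0s.
  by exists z.
have z0P j : z0 != slack j.
  by apply: contraNneq z0s => ->; exact: codom_f.
suff -> : completions (slack @: [set~ i0]) = [set z0] by rewrite cards1.
apply/setP => z; rewrite !inE; apply/andP/eqP => [[zt D]|->]; last first.
  split; first by apply: contra z0s => /imsetP[j _ ->]; exact: codom_f.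
  apply/dominantP => y; have [/codomP[j ->]|ys] := boolP (y \in codom slack).
    exists j => x _; have [->//|xj] := eqVneq x (slack j).
    exact/ltnW/slack_low.
  exists i0 => x; rewrite !inE => /orP[/eqP->|]; first exact: z0max.
  by move=> /imsetP[j]; rewrite !inE => ji ->; exact/ltnW/slack_high.
have {D} D : r i0 z0 <= r i0 z.
  have /dominantP/(_ z0)[i Hi] := D.
  have [<-|ii0] := eqVneq i i0; first by apply: Hi; rewrite !inE eqxx.
  have := Hi (slack i); rewrite leqNgt slack_low ?z0P//.
  move=> /(_ _)/notF[]; rewrite !inE imset_f ?orbT// !inE//.
apply: (@r_inj i0); apply/eqP; rewrite eqn_leq D andbT z0max//.
apply: contra zt => /codomP[j ej]; have [ji|ji] := eqVneq j i0.
  by move: D; rewrite ej ji leqNgt slack_low ?z0P.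
by rewrite ej imset_f// !inE.
Qed.

(** Removing x leaves the colours other than i0 only if the colour of x is
repeated; then the other point with this colour is the only other choice. *)
Lemma even_facets_not_rainbow (c : T -> I) i0 s :
  c @: s != [set: I] ->
  odd #|[set x in s | (#|s :\ x|.+1 == #|I|) && (c @: (s :\ x) == [set~ i0])]|
  = false.
Proof.
move=> cs; set Z := [set x in s | _].
have [->|[x]] := set_0Vmem Z; first by rewrite cards0.
rewrite inE => /and3P[xs /eqP sx /eqP cx].
have cxi0 : c x != i0.
  apply: contra cs => /eqP cxi0; rewrite -(finset.setD1K xs) imsetU1 cxi0 cx.
  by apply/eqP/setP => i; rewrite !inE orbN.
have inj_c : {in s :\ x &, injective c}.
  by apply/imset_injP; rewrite cx cardsC1 -sx.
have /imsetP[x' x's cxx'] : c x \in c @: (s :\ x) by rewrite cx !inE.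
have [x'x x's'] : x' != x /\ x' \in s by move: x's; rewrite !inE => /andP.
suff -> : Z = [set x; x'] by rewrite cards2 eq_sym x'x.
apply/setP => y; rewrite !inE; apply/idP/idP.
  move=> /and3P[ys _ /eqP cy]; apply: contraT; rewrite negb_or => /andP[yx yx'].
  have : c y \in c @: (s :\ y).
    by rewrite cy -cx imset_f// !inE yx.
  move=> /imsetP[u]; rewrite !inE => /andP[uy us] cu.
  have [ux|ux] := eqVneq u x.
    move: yx'; rewrite (inj_c y x') ?eqxx// ?cu ?ux ?cxx'//.
    by rewrite !inE yx.
  by move: uy; rewrite (inj_c y u) ?eqxx// !inE ?yx ?ux.
move=> /orP[/eqP->|/eqP->]; first by rewrite xs sx cx !eqxx.
rewrite x's' /=; apply/andP; split.
  have := cardsD1 x' s; rewrite x's' (cardsD1 x s) xs => /addnI <-.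
  by rewrite sx.
rewrite -cx finset.eqEsubset; apply/andP.
split; apply/fintype.subsetP => _ /imsetP[u + ->];
  rewrite !inE => /andP[ux us].
  have [->|ux'] := eqVneq u x; first by rewrite cxx' imset_f.
  by rewrite imset_f// !inE ux'.
have [->|ux'] := eqVneq u x'; first by rewrite -cxx' imset_f// !inE eq_sym x'x.
by rewrite imset_f// !inE ux'.
Qed.

(** Double counting of the pairs formed by a dominant set s with #|I| points and
a point x of s such that s :\ x has exactly the colours other than i0.  Counted
by s :\ x their number is odd, since only the boundary facet has an odd number
of completions.  Counted by s it is even unless some s has all the colours.
The slack points, each of which is the least one of its own order and above all
ordinary points in the others, provide the boundary. *)
Lemma scarf_rainbow (slack : I -> T) (c : T -> I) (i0 : I) x0 :
  (forall i x, x != slack i -> r i (slack i) < r i x) ->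
  (forall i x, x \notin codom slack -> forall j, j != i ->
     r i x < r i (slack j)) ->
  cancel slack c -> x0 \notin codom slack ->
  exists2 s, dominant s & c @: s = [set: I].
Proof.
move=> slack_low slack_high slackK x0s.
have [/existsP[s /andP[D /eqP]]|/existsPn no] :=
  boolP [exists s, dominant s && (c @: s == [set: I])]; first by exists s.
pose F := [set t : {set T} | (#|t|.+1 == #|I|) && (c @: t == [set~ i0])].
pose P := [set p : {set T} * T | (p.1 \in F) && (p.2 \in completions p.1)].
pose Q := [set q : {set T} * T | dominant q.1 &&
  (q.2 \in [set x in q.1 | q.1 :\ x \in F])].
have PQ : #|P| = #|Q|.
  pose f (p : {set T} * T) := (p.2 |: p.1, p.2).
  have finj : {in P &, injective f}.
    move=> [t z] [t' z']; rewrite !inE /= => /and3P[_ zt _] /and3P[_ zt' _].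
    move=> [e zz']; move: e zt'; rewrite -{}zz'.
    move=> /(congr1 (fun u => u :\ z)) + zt'; by rewrite !setU1K// => ->.
  rewrite -(card_in_imset finj); congr #|pred_of_set _|.
  apply/setP => -[s x]; apply/imsetP/idP => [[[t z]]|].
    rewrite [_ \in P]inE /= [z \in _]inE => /and3P[Ft zt D] [-> ->].
    by rewrite inE /= D inE setU1K// Ft setU11.
  rewrite inE /= [x \in _]inE => /and3P[D xs Fs].
  exists (s :\ x, x); last by rewrite /f/= finset.setD1K.
  by rewrite inE /= Fs inE finset.setD1K// D !inE eqxx.
have oddP : odd #|P|.
  have t0F : slack @: [set~ i0] \in F.
    rewrite inE card_imset ?cardsC1; last exact: can_inj slackK.
    rewrite prednK ?eqxx/=; last by apply/card_gt0P; exists i0.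
    rewrite -imset_comp; apply/eqP/setP => i; apply/imsetP/idP => [[j + ->]|ii].
      by rewrite /= slackK.
    by exists i; rewrite //= slackK.
  have -> : #|P| = \sum_(t in F) #|completions t|.
    under eq_bigr do rewrite -sum1_card.
    by rewrite pair_big_dep/= -sum1_card; apply: eq_bigl => p; rewrite inE.
  rewrite (big_morph odd oddD (erefl : odd 0 = false)).
  rewrite (bigD1 _ t0F)/= (outer_completion i0 slack_low slack_high x0s).
  rewrite big1// => t /andP[tF tt0].
  have := tF : t \in F; rewrite inE => /andP[/eqP tI /eqP ct].
  suff [x xt xs] : exists2 x, x \in t & x \notin codom slack.
    exact: (even_completions slack_high tI xt xs).
  apply/exists_inP; move: tt0; apply: contraNT => /exists_inPn all_slack.
  rewrite -ct -imset_comp; apply/eqP/setP => x.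
  apply/idP/imsetP => [xt|[y yt ->]].
    exists x => //=; have /negPn/codomP[j ->] := all_slack _ xt.
    by rewrite slackK.
  by have /negPn/codomP[j e] := all_slack _ yt; rewrite /= e slackK -e.
suff : odd #|Q| = false by rewrite -PQ oddP.
have -> : #|Q| = \sum_(s | dominant s) #|[set x in s | s :\ x \in F]|.
  under eq_bigr do rewrite -sum1_card.
  by rewrite pair_big_dep/= -sum1_card; apply: eq_bigl => p; rewrite [LHS]inE.
rewrite (big_morph odd oddD (erefl : odd 0 = false)) big1// => s D.
have := no s; rewrite D /= => cs.
rewrite -(even_facets_not_rainbow i0 cs); congr (odd #|pred_of_set _|).
by apply/setP => x; rewrite !inE.
Qed.
End Scarf.

(** * A labelling theorem for the simplex *)

Lemma ltn_digits B a b d e : d < B -> e < B -> a < b -> a * B + d < b * B + e.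
Proof.
move=> dB eB ab; apply: (@leq_trans (a.+1 * B)); last first.
  by apply: leq_trans (leq_addr _ _); rewrite leq_mul2r ab orbT.
by rewrite mulSn addnC ltn_add2r.
Qed.

(** Raising one coordinate turns a vector with too small a sum into a point of
the grid. *)
Lemma grid_fill (I : finType) N (q : I -> nat) i1 : \sum_i q i <= N ->
  exists2 y : {ffun I -> 'I_N.+1}, \sum_i (y i : nat) = N &
    forall i, y i = q i + (i == i1) * (N - \sum_i q i) :> nat.
Proof.
move=> qN; pose q' i := q i + (i == i1) * (N - \sum_i q i).
have sq' : \sum_i q' i = N.
  rewrite big_split/= [X in _ + X](bigD1 i1)//= eqxx mul1n.
  rewrite [X in _ + (_ + X)]big1 ?addn0 ?subnKC// => i /negbTE -> //.
have q'N i : q' i < N.+1 by rewrite ltnS -sq' (bigD1 i)//= leq_addr.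
exists [ffun i => Ordinal (q'N i)]; last by move=> i; rewrite ffunE.
by rewrite -[RHS]sq'; apply: eq_bigr => i _; rewrite ffunE.
Qed.

(** Scarf's lemma is applied to the grid points, ordered by each of their
coordinates, with ties broken by an enumeration.  Let s be the dominant set with
all the labels, S the set of indices whose slack point is not in s, and m_i the
least i-th coordinate of the grid points of s.  If the numbers m_i + 1 for i in S had
a sum at most N, a grid point would exceed s in all the coordinates of S; so the
sum of the m_i is almost N, and every grid point of s, being above m, is close
to the vector that equals m on S and 0 elsewhere.  Raising one coordinate of
this vector gives p. *)
Lemma simplex_labelling (I : finType) (i0 : I) N
    (c : {ffun I -> 'I_N.+1} -> I) :
  exists2 p : {ffun I -> 'I_N.+1}, \sum_i (p i : nat) = N &
  forall i, p i != 0 :> nat -> exists t : {ffun I -> 'I_N.+1},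
    [/\ \sum_j (t j : nat) = N, c t = i &
        forall j, (t j <= p j + #|I|) && (p j <= t j + #|I|)].
Proof.
pose G := {t : {ffun I -> 'I_N.+1} | \sum_i (t i : nat) == N}.
pose T : finType := (G + I)%type.
(* two-digit numbers in base #|G|, the second digit breaking the ties; the
   first digit of a slack point in the order of another index is N + 1 *)
pose r (i : I) (x : T) := match x with
  | inl t => (val t i * #|{: G}| + enum_rank t).+1
  | inr j => if j == i then 0 else (N.+1 * #|{: G}| + enum_rank j).+1 end.
have digit (t t' : G) i : (val t i <= val t' i) || (r i (inl t') < r i (inl t)).
  by rewrite leqNgt -implybE; apply/implyP => lt /=; rewrite ltnS ltn_digits.
have top_digit (t : G) i k :
    (val t i * #|{: G}| + enum_rank t) < (N.+1 * #|{: G}| + k).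
  apply: leq_trans (leq_addr _ _); rewrite -[X in _ < X]addn0.
  by apply: ltn_digits => //; apply: leq_trans (ltn_ord (enum_rank t)).
have r_inj i : injective (r i).
  move=> [t|j] [t'|j'] /=.
  - move=> [e]; congr inl; apply/enum_rank_inj/val_inj/eqP.
    move: e => /eqP; case: (ltngtP (val t i) (val t' i)) => [lt|lt|->].
    + by rewrite ltn_eqF// ltn_digits.
    + by rewrite gtn_eqF// ltn_digits.
    + by rewrite eqn_add2l.
  - by case: eqP => // _ [] /eqP; rewrite ltn_eqF//; exact: top_digit.
  - by case: eqP => // _ [] /eqP; rewrite gtn_eqF//; exact: top_digit.
  - case: eqP => [->|_]; case: eqP => [->|_] //.
    by move=> [/addnI/val_inj/enum_rank_inj->].
pose c' (x : T) := match x with inl t => c (val t) | inr i => i end.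
have slackN (t : G) : inl t \notin codom (inr : I -> T).
  by apply/negP => /codomP[].
have [y0 y0N _] :
    exists2 y : {ffun I -> 'I_N.+1}, \sum_i (y i : nat) = N & True.
  have [|y yN _] := @grid_fill I N (fun=> 0) i0; last by exists y.
  by rewrite big1.
have [|i x xs j ji|i||s /dominantP dom_s c's] :=
    @scarf_rainbow T I r r_inj inr c' i0 (inl (Sub y0 (introT eqP y0N))).
- move=> i [t|j] //= ji; rewrite eqxx //.
  by case: (eqVneq j i) ji => [->|//]; rewrite eqxx.
- case: x xs => [t _|k]; last by rewrite codom_f.
  by rewrite /= (negbTE ji) ltnS top_digit.
- by [].
- exact: slackN.
pose S := [set i | inr i \notin s].
have S_dom (t : G) : exists2 i, i \in S &
    forall t' : G, inl t' \in s -> val t i <= val t' i.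
  have [i Hi] := dom_s (inl t); exists i.
    by rewrite inE; apply/negP => /Hi /=; rewrite eqxx.
  move=> t' /Hi; case/orP: (digit t t' i) => //.
  by rewrite ltnNge => /negbTE ->.
have S_col i : i \in S -> exists2 t : G, inl t \in s & c (val t) = i.
  rewrite inE => iS; have : i \in c' @: s by rewrite c's.
  by move=> /imsetP[[t|j] xs e]; [exists t | rewrite e xs in iS].
have [i1 i1S _] := S_dom (Sub y0 (introT eqP y0N)).
have [t0 t0s _] := S_col _ i1S.
pose A := [pred t : G | inl t \in s].
pose m i := val [arg min_(t < t0 | A t) val t i] i : nat.
have mle i (t : G) : inl t \in s -> m i <= val t i.
  by move=> ts; rewrite /m; case: arg_minnP => // t' _; apply.
have mex i : exists2 t : G, inl t \in s & m i = val t i.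
  by rewrite /m; case: arg_minnP => // t' ts _; exists t'.
pose q i := (i \in S) * m i.
have qle j (t : G) : inl t \in s -> q j <= val t j.
  by move=> ts; rewrite /q; case: (j \in S); rewrite ?mul1n ?mle.
have sumq : \sum_i q i <= N.
  by rewrite -(eqP (valP t0)); apply: leq_sum => i _; exact: qle.
have slack_q : N - \sum_i q i <= #|I|.
  rewrite leqNgt; apply/negP => big.
  have sumq' : \sum_i (q i + (i \in S)) <= N.
    rewrite big_split/= -leq_subRL//; apply: leq_trans (ltnW big).
    by rewrite -sum1_card; apply: leq_sum => i _; case: (i \in S).
  have [y yN yE] := @grid_fill _ _ _ i1 sumq'.
  have [i iS /(_ _)Hi] := S_dom (Sub y (introT eqP yN)).
  have [t ts mt] := mex i; have := Hi _ ts.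
  by rewrite /= yE /q iS mul1n addn1 -mt addSn ltnNge leq_addr.
have [p pN pE] := grid_fill i1 sumq.
exists p => // i pi; have iS : i \in S.
  apply: contraNT pi => iS; rewrite pE /q (negbTE iS).
  by have -> : i == i1 = false by apply: contraNF iS => /eqP->.
have [t ts ct] := S_col _ iS; exists (val t); split=> //.
  exact/eqP/(valP t).
move=> j; rewrite pE; apply/andP; split; last first.
  by rewrite leq_add ?qle//; case: (j == i1); rewrite ?mul1n.
apply: (@leq_trans (q j + #|I|)); last by rewrite leq_add2r leq_addr.
rewrite -leq_subLR; apply: leq_trans slack_q.
rewrite -[X in _ <= X - _](eqP (valP t)) -sumnB; last by move=> ? _; exact: qle.
by rewrite (bigD1 j)//= leq_addr.
Qed.

Local Open Scope classical_set_scope.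
Local Open Scope ring_scope.

(** * Finite convex combinations *)

Section convex_sets.
Context {R : realType} {E : lmodType R}.
Implicit Types A : set E.

Lemma convex_setP A : convex_set A <->
  forall (x y : E) (l : R), 0 <= l -> l <= 1 -> A x -> A y ->
    A (l *: x + (1 - l) *: y).
Proof.
split=> [cA x y l l0 l1 /mem_set Ax /mem_set Ay|H x y l].
  exact/set_mem/(cA x y (Itv01 l0 l1)).
by move=> /set_mem Ax /set_mem Ay; apply/mem_set; exact: H.
Qed.

Lemma convex_sum A (I : finType) (w : I -> R) (y : I -> E) :
  convex_set A -> (forall i, 0 <= w i) -> \sum_i w i = 1 ->
  (forall i, w i != 0 -> A (y i)) -> A (\sum_i w i *: y i).
Proof.
move=> /convex_setP cA w0 w1 Ay.
suff H s : \sum_(i <- s) w i != 0 ->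
    A ((\sum_(i <- s) w i)^-1 *: \sum_(i <- s) w i *: y i).
  have := H (index_enum I); rewrite w1 invr1 scale1r; apply.
  by rewrite oner_eq0.
elim: s => [|a s IH]; first by rewrite big_nil eqxx.
rewrite !big_cons; have [wa|wa] := eqVneq (w a) 0.
  by rewrite wa scale0r !add0r.
have s0 : 0 <= \sum_(i <- s) w i by apply: sumr_ge0.
have [ws _|ws wS] := eqVneq (\sum_(i <- s) w i) 0.
  rewrite ws [\sum_(i <- s) _ *: _]big1_seq => [|i /andP[_ is_]].
    by rewrite !addr0 scalerA mulVf// scale1r; exact: Ay.
  move/eqP: ws; rewrite psumr_eq0// => /allP/(_ _ is_)/eqP ->.
  by rewrite scale0r.
set W := w a + _ in wS *.
have W0 : 0 < W by rewrite lt_neqAle eq_sym wS addr_ge0.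
have := cA (y a) _ (w a / W) _ _ (Ay _ wa) (IH ws).
rewrite divr_ge0 ?(ltW W0)// ler_pdivrMr// mul1r lerDl => /(_ isT s0).
suff -> : 1 - w a / W = (\sum_(i <- s) w i) / W.
  by rewrite scalerA mulrAC divff// mul1r scalerDr !scalerA mulrC.
by apply: (mulIf wS); rewrite mulrBl !divfK// mul1r /W addrAC subrr add0r.
Qed.

End convex_sets.

(** * Approximate fixed points *)

Section tvs.
Context {R : realType} {X : tvsType R}.
Implicit Types U V C : set X.

Lemma nbhs0_split U : nbhs 0 U ->
  exists2 V, nbhs 0 V & forall x y, V x -> V y -> U (x + y).
Proof.
move=> U0; have := @add_continuous X (0, 0) U; rewrite /= addr0 => /(_ U0).
move=> [[V1 V2] /= [V10 V20] VU]; exists (V1 `&` V2); first exact: filterI.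
by move=> x y [V1x _] [_ V2y]; exact: (VU (x, y)).
Qed.

Lemma near_sub U (x : X) : nbhs 0 U -> \forall a \near x & b \near x, U (a - b).
Proof.
move=> U0; have := @sub_continuous X (x, x) U; rewrite /= subrr; exact.
Qed.

Lemma scalel_continuous (z : X) : continuous (fun l : R => l *: z).
Proof.
move=> l U Ulz.
have [[A B] /= [Al Bz] AB] := @scale_continuous R X (l, z) U Ulz.
apply: (@filterS _ _ _ A) => // l' Al'; apply: (AB (l', z)); split=> //.
exact: nbhs_singleton.
Qed.

Lemma small_combination (I : finType) (y : I -> X) U : nbhs 0 U ->
  exists2 e : R, 0 < e &
    forall d : I -> R, (forall i, `|d i| < e) -> U (\sum_i d i *: y i).
Proof.
move: U; suff H s U : nbhs 0 U -> exists2 e : R, 0 < e &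
    forall d : I -> R, (forall i, `|d i| < e) -> U (\sum_(i <- s) d i *: y i).
  exact: H.
elim: s U => [|a s IH] U U0.
  by exists 1 => // d _; rewrite big_nil; exact: nbhs_singleton.
have [V V0 VU] := nbhs0_split U0.
have [e1 e10 H1] := IH _ V0.
have : nbhs (0 : R) [set l : R | V (l *: y a)].
  by apply: (@scalel_continuous (y a)); rewrite scale0r.
move=> /nbhs_ballP[e2 /= e20 H2].
exists (Num.min e1 e2); first by rewrite lt_min e10.
move=> d de; rewrite big_cons; apply: VU.
  apply: H2; rewrite -ball_normE /= sub0r normrN.
  by have := de a; rewrite lt_min => /andP[].
by apply: H1 => i; have := de i; rewrite lt_min => /andP[].
Qed.

(** The filter F on lists makes precise that l is large: it is generated by the
families of all lists that contain a given one, and near covering then yields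
a list that serves for all x at once. *)
Lemma finite_net {T : topologicalType} (f : T -> X) U :
  compact [set: T] -> continuous f -> nbhs 0 U ->
  exists l : seq T, forall x, exists2 a, a \in l & U (f a - f x).
Proof.
move=> /compact_near_coveringP cT cf U0.
pose F : set_system (seq T) :=
  filter_from [set: seq T] (fun l => [set l' : seq T | {subset l <= l'}]).
have FF : Filter F.
  apply: filter_from_filter; first by exists [::].
  move=> l1 l2 _ _; exists (l1 ++ l2) => // l H.
  by split=> a al; apply: H; rewrite mem_cat al ?orbT.
have [x _|l /= _ H] :=
    cT _ F (fun l x => exists2 a, a \in l & U (f a - f x)) FF.
  exists ([set x' | U (f x - f x')], [set l : seq T | x \in l]) => /=.
    split; last first.
      by exists [:: x] => // l' sub; apply: sub; rewrite inE.
    have [[A B] /= [Ax Bx] AB] := near_sub (f x) U0.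
    have : nbhs x (f @^-1` B) by exact: cf.
    apply: filterS => b Bb; apply: (AB (f x, f b)); split=> //.
    exact: nbhs_singleton.
  by move=> [x' l'] /= [Ux xl]; exists x.
by exists l => x; exact: (H l).
Qed.

Lemma compact_set_type C : compact C -> compact [set: C].
Proof.
move=> cC F PF FT.
have FC : F (set_val @^-1` C) by apply: filterS FT => y _; exact: set_valP.
have [x [Cx clx]] := cC _ (fmap_proper_filter set_val PF) FC.
exists (exist _ x (mem_set Cx)); split=> // A B FA [_ [[B' oB' <-] /= B'x]] sB.
have FA' : F (set_val @^-1` (set_val @` A)).
  by apply: filterS FA => y Ay; exists y.
have [_ [[y Ay <-] B'y]] := clx _ B' FA' (open_nbhs_nbhs (conj oB' B'x)).
by exists y; split=> //; exact: sB.
Qed.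

(** The label of a point t of the simplex is an index i such that a_i is close
to the combination of the y_j with weights t_j.  Points of the grid whose
coordinates differ by at most n / N have almost the same combinations, so that
the point p given by the labelling theorem has the required property. *)
Lemma approximate_fixed_point C (M : C -> set C) V :
  convex_set C -> compact C -> C !=set0 -> (forall x, M x !=set0) ->
  nbhs 0 V ->
  exists n (a y : 'I_n -> C) (w : 'I_n -> R) (x : C),
    [/\ (forall i, 0 <= w i), \sum_i w i = 1,
        set_val x = \sum_j w j *: set_val (y j),
        (forall i, M (a i) (y i)) &
        forall i, w i != 0 -> V (set_val (a i) - set_val x)].
Proof.
move=> convC cC [x0 Cx0] M0 V0.
have [U U0 UV] := nbhs0_split V0.
have [l lnet] :=
  finite_net (compact_set_type cC) (@initial_continuous _ _ _) U0.
pose n := size l; pose a (i : 'I_n) := tnth (in_tuple l) i.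
have net x : C x -> exists i, U (set_val (a i) - x).
  move=> Cx; have [z /seq_tnthP[i ->] Ux] := lnet (exist _ x (mem_set Cx)).
  by exists i.
have [i0 _] := net _ Cx0.
have [y My] := choice (fun i => M0 (a i)).
have [e e0 He] := small_combination (set_val \o y) U0.
pose N := (Num.truncn (n%:R / e)).+1.
have N0 : 0 < N%:R :> R by rewrite ltr0n.
have Ne : n%:R / N%:R < e.
  by rewrite ltr_pdivrMr// mulrC -ltr_pdivrMr//; exact: truncnS_gt.
pose wt (t : {ffun 'I_n -> 'I_N.+1}) j : R := (t j)%:R / N%:R.
have wt0 t j : 0 <= wt t j by rewrite divr_ge0.
have wt1 (t : {ffun 'I_n -> 'I_N.+1}) :
    (\sum_j (t j : nat))%N = N -> \sum_j wt t j = 1.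
  by move=> tN; rewrite -mulr_suml -natr_sum tN divff// gt_eqF.
pose b (t : {ffun 'I_n -> 'I_N.+1}) := \sum_j wt t j *: set_val (y j).
have bC (t : {ffun 'I_n -> 'I_N.+1}) : (\sum_j (t j : nat))%N = N -> C (b t).
  move=> tN; apply: convex_sum => //; first exact: wt1.
  by move=> j _; exact: set_valP.
have label (t : {ffun 'I_n -> 'I_N.+1}) :
    exists i, (\sum_j (t j : nat))%N = N -> U (set_val (a i) - b t).
  have [tN|tN] := pselect ((\sum_j (t j : nat))%N = N); last by exists i0.
  have [i Ui] : exists i, U (set_val (a i) - b t); last by exists i.
  exact/net/bC.
have [c Uc] := choice label.
have [p pN pP] := simplex_labelling i0 c.
exists n, a, y, (wt p), (exist (fun z => z \in C) _ (mem_set (bC _ pN))).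
split=> // [|i]; first exact: wt1.
rewrite /wt mulf_eq0 pnatr_eq0 negb_or => /andP[/pP[t [tN cti tp]] _].
rewrite -(subrK (b t) (set_val (a i))) -addrA.
apply: UV; first by rewrite -cti; exact: Uc.
rewrite /b -sumrB; under eq_bigr do rewrite -scalerBl.
apply: He => j; apply: le_lt_trans Ne.
rewrite -mulrBl normrM [ `|_^-1|]ger0_norm ?invr_ge0 ?ler0n//.
rewrite ler_pM2r ?invr_gt0// ler_norml.
have := tp j; rewrite card_ord => /andP[tp1 tp2].
by rewrite lerBrDl lerBlDr lerBlDl -!natrD !ler_nat tp2.
Qed.

End tvs.

(** * The fixed-point theorem of Kakutani, Fan and Glicksberg *)

Lemma closed_svmap_near {T : topologicalType} (M : T -> set T) (x y : T) :
  closed_svmap M -> ~ M x y -> \forall x' \near x & y' \near y, ~ M x' y'.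
Proof.
move=> /closed_openC oM nMxy.
by have := open_nbhs_nbhs (conj oM (nMxy : (~` [set p | M p.1 p.2]) (x, y))).
Qed.

(** Closed maps into a compact space are upper semicontinuous: each y outside A
is not in M x, so points near y stay out of M x' for x' near x, and finitely
many such neighbourhoods cover the complement of A. *)
Lemma closed_svmap_upper {T : topologicalType} (M : T -> set T) (A : set T) x :
  compact [set: T] -> closed_svmap M -> open A -> M x `<=` A ->
  \forall x' \near x, M x' `<=` A.
Proof.
move=> /compact_near_coveringP cT clM oA MxA.
have H y : [set: T] y -> \forall y' \near y & x' \near x, M x' y' -> A y'.
  move=> _; have [Ay|nAy] := pselect (A y).
    exists (A, setT) => /=.
      by split; [exact: open_nbhs_nbhs|exact: filterT].
    by move=> [y' x'] [].
  have [[N1 N2] /= [N1x N2y] N] :=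
    closed_svmap_near clM (contra_not (@MxA y) nAy).
  by exists (N2, N1) => // -[y' x'] /= [y'N x'N] /(N (x', y') (conj x'N y'N)).
have := cT _ (nbhs x) (fun x' y => M x' y -> A y) _ H.
by move=> /(_ _); apply: filterS => x' Hx' y; exact: Hx'.
Qed.

Section kakutani.
Context {R : realType} {X : tvsType R}.

Lemma convex_nbhs0 (U : set X) : nbhs 0 U -> exists V : set X,
  [/\ convex_set V, open V, V 0 & V `<=` U].
Proof.
have [B convB [oB basisB]] := @locally_convex R X.
move=> /(basisB 0)[V [BV V0] VU]; exists V; split => //; last exact: oB.
by apply: convB; exact: mem_set.
Qed.

Lemma nbhs_shift (U : set X) (x y : X) :
  nbhs (x + y) U -> nbhs x [set z | U (z + y)].
Proof.
move=> Uxy; have := @add_continuous X (x, y) U Uxy.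
move=> [[A B] /= [Ax By] AB]; apply: filterS Ax => z Az.
by apply: (AB (z, y)); split=> //; exact: nbhs_singleton.
Qed.

(** [far] is the local obstruction: if x is not in M x, some convex open V
makes x + V disjoint from A = M x + V; by upper semicontinuity M takes its
values in the convex set A near x, and then so do the convex combinations of
these values, which are therefore not in x + V. *)
Theorem kakutani_fan_glicksberg (C : set X) (M : C -> set C) :
  convex_set C -> compact C -> C !=set0 ->
  closed_svmap M -> convex_valued M -> (forall x, M x !=set0) ->
  exists x, M x x.
Proof.
move=> convC cC C0 clM convM M0; apply: contrapT => nofix.
have cT := compact_set_type cC.
have sv_cont (y : C) (P : set X) :
    nbhs (set_val y) P -> nbhs y (set_val @^-1` P).
  exact: initial_continuous.
pose approx (V : set X) (x : C) := exists n (a y : 'I_n -> C) (w : 'I_n -> R),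
    [/\ (forall i, 0 <= w i), \sum_i w i = 1,
        set_val x = \sum_j w j *: set_val (y j),
        (forall i, M (a i) (y i)) &
        forall i, w i != 0 -> V (set_val (a i) - set_val x)].
have far (x : C) : \forall x' \near x &
    V \near powerset_filter_from (nbhs (0 : X)), ~ approx V x'.
  have nMx : ~ M x x by move=> Mx; apply: nofix; exists x.
  have [V1 V10 V1P] : exists2 V1 : set X, nbhs 0 V1 &
      forall y : C, M x y -> forall u v, V1 u -> V1 v ->
      set_val y - set_val x != u - v.
    have [[N1 N2] /= [N1x N2x] N] := closed_svmap_near clM nMx.
    move: N2x => [_ [[G oG <-] /= Gx] GN].
    have G0 : nbhs 0 [set u | G (u + set_val x)].
      by apply: nbhs_shift; rewrite add0r; exact: open_nbhs_nbhs.
    have := near_sub 0 G0.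
    move=> [[W1 W2] /= [W10 W20] W]; exists (W1 `&` W2); first exact: filterI.
    move=> y My u v [W1u _] [_ W2v]; apply/eqP => e.
    apply: (N (x, y)) => //; split; first exact: nbhs_singleton.
    apply: GN => /=; have := W (u, v) (conj W1u W2v).
    by rewrite /= -e subrK.
  have [V [convV oV V0 VV1]] := convex_nbhs0 V10.
  pose A : set X := [set z | exists2 m, M x m & V (z - set_val m)].
  have convA : convex_set A.
    apply/convex_setP => z1 z2 l l0 l1 [m1 Mm1 V1z] [m2 Mm2 V2z].
    have /convex_setP/(_ _ _ _ l0 l1 (imageP _ Mm1) (imageP _ Mm2))[m Mm mE] :=
      convM x.
    exists m => //; rewrite mE.
    have /convex_setP/(_ _ _ _ l0 l1 V1z V2z) := convV.
    by rewrite !scalerBr addrACA -opprD.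
  have oA : open [set y : C | A (set_val y)].
    rewrite openE => y [m Mm Vym]; rewrite /interior.
    have : nbhs (set_val y) [set z | V (z - set_val m)].
      exact/nbhs_shift/open_nbhs_nbhs.
    by move=> /sv_cont; apply: filterS => y' Vy'; exists m.
  have MA : M x `<=` [set y | A (set_val y)].
    by move=> m Mm; exists m => //; rewrite subrr.
  have [_ [[G oG <-] /= Gx] GA] := closed_svmap_upper cT clM oA MA.
  have G0 : nbhs 0 [set u | G (u + set_val x)].
    by apply: nbhs_shift; rewrite add0r; exact: open_nbhs_nbhs.
  have [W W0 WG] := nbhs0_split G0.
  have near_x : \forall x' \near x, (W `&` V) (set_val x' - set_val x).
    have : nbhs (set_val x) [set z | (W `&` V) (z - set_val x)].
      apply: nbhs_shift; rewrite subrr.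
      by apply: filterI => //; exact: open_nbhs_nbhs.
    by move=> /sv_cont.
  exists ([set x' | (W `&` V) (set_val x' - set_val x)],
          [set V' | V' `<=` W]) => /=.
    by split => //; exact: small_set_sub.
  move=> [x' V'] /= [[Wx' Vx'] V'W] [n [a [y [w [w0 w1 x'E May aV']]]]].
  have [m Mm Vm] : A (set_val x').
    rewrite x'E; apply: convex_sum => // i wi.
    apply: (GA (a i)) (May i) => /=.
    have := WG _ _ Wx' (V'W _ (aV' i wi)).
    by rewrite /= addrAC subrK subrKC.
  have /eqP := V1P m Mm _ _ (VV1 _ Vx') (VV1 _ Vm); apply.
  by rewrite opprB [RHS]addrC subrKA.
have /compact_near_coveringP := cT.
move=> /(_ _ (powerset_filter_from (nbhs (0 : X))) (fun V x => ~ approx V x)).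
move=> /(_ _ (fun x _ => far x)) H.
have [V [V0 HV]] : exists V : set X, nbhs 0 V /\ forall x, ~ approx V x.
  near (powerset_filter_from (nbhs (0 : X))) => V.
  exists V; split; first by near: V; exact: near_small_set.
  have HV : [set: C] `<=` (fun x => ~ approx V x) by near: V.
  by move=> x; exact: HV.
have [n [a [y [w [x Hx]]]]] := approximate_fixed_point convC cC C0 M0 V0.
by apply: (HV x); exists n, a, y, w.
Unshelve. all: by end_near.
Qed.

End kakutani.

(** * Minimizers of h on the values of K *)

Definition argmin_svmap {R : realType} {T : Type} (h : T -> R)
    (K : T -> set T) : T -> set T :=
  fun x => [set y | K x y /\ forall z, K x z -> h y <= h z].

Section argmin.
Context {R : realType} {T : topologicalType}.
Variables (h : T -> R) (K : T -> set T).

Lemma argmin_QOpt x : argmin_svmap h K x x -> QOpt h K x.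
Proof.
move=> [Kxx minx]; split=> //; split; first by exists x.
by move=> _ [z Kxz <-]; exact: minx.
Qed.

(** If y in K x is not a minimizer, some z in K x has h z < c < h y.  Near x the
values of K still meet the open set where h < c, and near y still h > c. *)
Lemma closed_argmin : closed_svmap K -> lower_semicontinuous_svmap K ->
  continuous h -> closed_svmap (argmin_svmap h K).
Proof.
move=> clK lscK ch; rewrite /closed_svmap -openC openE => -[x y] /= nMxy.
rewrite /interior.
have [Kxy|nKxy] := pselect (K x y); last first.
  have := closed_svmap_near clK nKxy.
  by apply: filterS => -[x' y'] /= nK [].
have [z Kxz hzy] : exists2 z, K x z & h z < h y.
  apply: contrapT => no; apply: nMxy; split=> // z Kxz.
  by rewrite leNgt; apply/negP => hzy; apply: no; exists z.
pose c := (h z + h y) / 2.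
have [zc cy] := midf_lt hzy.
have oL : open (h @^-1` [set r | r < c]).
  by move/continuousP : ch; apply; exact: open_lt.
have oU : open (h @^-1` [set r | r > c]).
  by move/continuousP : ch; apply; exact: open_gt.
exists ([set x' | K x' `&` (h @^-1` [set r | r < c]) !=set0],
        h @^-1` [set r | r > c]) => /=.
  split; apply: open_nbhs_nbhs; split => //; first exact: lscK.
  by exists z.
move=> [x' y'] /= [[z' [Kz' hz']] hy'] [_ /(_ _ Kz')].
by rewrite leNgt (lt_trans hz' hy').
Qed.

Lemma argmin_nonempty x : compact [set: T] -> closed_svmap K ->
  continuous h -> K x !=set0 -> argmin_svmap h K x !=set0.
Proof.
move=> cT clK ch K0.
have clKx : closed (K x).
  rewrite -openC openE => y nKxy; rewrite /interior.
  have [[A B] /= [Ax By] AB] := closed_svmap_near clK nKxy.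
  apply: filterS By => y' By'; apply: (AB (x, y')); split=> //.
  exact: nbhs_singleton.
have cKx : compact (K x) := subclosed_compact clKx cT (@subsetT _ _).
have [y /set_mem Ky ymin] := compact_EVT_min K0 cKx (continuous_subspaceT ch).
by exists y; split=> // z /mem_set; exact: ymin.
Qed.

End argmin.

Section convex.
Context {R : realType} {X : tvsType R}.
Variable C : set X.

(** The minimizers form the intersection of K x with a sublevel set of h. *)
Lemma convex_argmin (h : C -> R) (K : C -> set C) :
  convex_valued K -> quasiconvex h -> convex_valued (argmin_svmap h K).
Proof.
move=> convK qh x; apply/convex_setP.
move=> _ _ l l0 l1 [y1 [Ky1 min1] <-] [y2 [Ky2 min2] <-].
have /convex_setP/(_ _ _ _ l0 l1 (imageP _ Ky1) (imageP _ Ky2))[y Ky yE] :=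
  convK x.
exists y => //; split=> // z Kz; apply: le_trans (min1 _ Kz).
have y1L : [set u | h u <= h y1] y1 by exact: lexx.
have y2L : [set u | h u <= h y1] y2 by exact: min2.
have /convex_setP/(_ _ _ _ l0 l1 (imageP _ y1L) (imageP _ y2L))[y' hy' y'E] :=
  qh (h y1).
by suff -> : y = y' by []; apply: val_inj; rewrite /= [LHS]yE.
Qed.

(** The segments from one point x of C are connected, share x and cover C. *)
Lemma convex_connected : convex_set C -> connected C.
Proof.
move=> /convex_setP convC.
have [->|/set0P[x Cx]] := eqVneq C set0; first exact: connected0.
pose f (y : X) (l : R) := l *: x + (1 - l) *: y.
have -> : C = \bigcup_(y in C) (f y @` `[0, 1]).
  apply/seteqP; split=> [y Cy|_ [y Cy [l /= + <-]]].
    exists y => //; exists 0; first by rewrite /= in_itv/= lexx ler01.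
    by rewrite /f scale0r subr0 scale1r add0r.
  by rewrite in_itv/= => /andP[l0 l1]; exact: convC.
apply: bigcup_connected.
  exists x => y Cy; exists 1; first by rewrite /= in_itv/= lexx ler01.
  by rewrite /f scale1r subrr scale0r addr0.
move=> y Cy; apply: connected_continuous_connected.
  exact: segment_connected.
apply: continuous_subspaceT => l.
have -> : f y = fun l => l *: (x - y) + y.
  by apply/funext => t; rewrite /f scalerBl scale1r scalerBr addrAC addrA.
by move=> U /nbhs_shift; exact: scalel_continuous.
Qed.

(** The set D of all x with K x nonempty is open by lower semicontinuity.  It is
closed by upper semicontinuity, since its complement consists of the x whose
value lies in the open set [set0].  As C is connected, D is everything. *)
Lemma nonempty_values (K : C -> set C) :
  convex_set C -> compact C -> (exists x, K x !=set0) ->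
  closed_svmap K -> lower_semicontinuous_svmap K -> forall x, K x !=set0.
Proof.
move=> /convex_connected connC /compact_set_type cT [x0 Kx0] clK lscK x.
pose D : set C := [set x | K x !=set0].
have oD : open D.
  by have := lscK _ openT; congr (open _); apply/seteqP; split=> z;
     rewrite /D/= setIT.
have oDc : open (~` D).
  rewrite openE => y nKy; rewrite /interior.
  have Ky0 : K y `<=` set0 by move=> z Kyz; apply: nKy; exists z.
  apply: filterS (closed_svmap_upper cT clK open0 Ky0) => y' Ky' [z].
  exact: Ky'.
have [G oG GE] := oD; have [G' oG' GE'] := oDc.
have eqC : set_val @` D = C.
  apply: connC.
  - by exists (set_val x0); exists x0.
  - exists G => //; rewrite -GE; apply/seteqP; split=> [_ [y Gy <-]|y [Cy Gy]].
      by split => //; exact: set_valP.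
    by exists (exist _ y (mem_set Cy)).
  - exists (~` G'); first exact: open_closedC.
    apply/seteqP; split=> [_ [y Dy <-]|y [Cy Gy]].
      split; first exact: set_valP.
      by move=> G'y; have : (~` D) y by rewrite -GE'.
    exists (exist (fun z => z \in C) y (mem_set Cy)) => //.
    apply: contrapT => nD; apply: Gy.
    move: nD; change ((~` D) (exist (fun z => z \in C) y (mem_set Cy)) -> G' y).
    by rewrite -GE'.
have : C (set_val x) by exact: set_valP.
by rewrite -{1}eqC => -[y Dy /val_inj <-].
Qed.

End convex.

(* K_nontrivial makes explicit that the set-valued map is not empty-valued; it
   is implied by the conclusion. It forces C to be nonempty, and with the other
   hypotheses it forces every value of K to be nonempty. *)
Theorem theorem3p1 (R : realType) (X : tvsType R) (hausdorffX : hausdorff_space X)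
  (C : set X) (convexC : convex_set C) (compactC : compact C)
  (h : C -> R) (K : C -> set C)
  (K_nontrivial : exists x : C, K x !=set0)
  (K_closed : closed_svmap K)
  (K_lsc : lower_semicontinuous_svmap K)
  (K_convex : convex_valued K)
  (h_quasiconvex : quasiconvex h)
  (h_continuous : continuous h) :
  QOpt h K !=set0.
Proof.
have K0 := nonempty_values convexC compactC K_nontrivial K_closed K_lsc.
have [x Mxx] : exists x, argmin_svmap h K x x.
  apply: (kakutani_fan_glicksberg convexC compactC).
  - by have [x _] := K_nontrivial; exists (set_val x); exact: set_valP.
  - exact: closed_argmin.
  - exact: convex_argmin.
  - by move=> x; apply: argmin_nonempty => //; exact: compact_set_type.
by exists x; exact: argmin_QOpt.
Qed.
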